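(* Let $U(X)=\sum_{n\ge 0}u_nX^n\in\mathbb{F}_2[[X]]$ be the compositional inverse of the generating function $D(X)=\sum_{n\ge 0}d_nX^n\in\mathbb{F}_2[[X]]$ of the period-doubling sequence. Then $U(X)$ satisfies each of the following polynomial equations over $\mathbb{F}_2[[X]]$: \[ X^2U(X)^3+XU(X)^2+(X^2+1)U(X)+X=0, \] \[ X^3U(X)^4+X^3U(X)^2+U(X)+X=0. \] In particular, the sequence $(u_n)_{n\ge 0}$ satisfies $u_0=0$, $u_1=1$, and, over $\mathbb{F}_2$, \[ u_{2n}=0\ \ \forall n\ge 0,\qquad u_{4n+1}=u_{2n-1}\ \ \forall n\ge 1,\qquad u_{4n+3}=u_n\ \ \forall n\ge 0. \]
   Context: The period-doubling sequence $\boldsymbol{d}=(d_n)_{n\ge 0}$ is defined by $d_n=\nu_2(n+1)\bmod 2\in\{0,1\}$, where $\nu_2(m)$ is the exponent of the highest power of $2$ dividing $m$. Since $d_0=0$ and $d_1=1$ is invertible in $\mathbb{F}_2$, there is a (unique) series $U(X)\in\mathbb{F}_2[[X]]$ with zero constant term, called the formal (compositional) inverse of $D(X)$, such that $D(U(X))=X=U(D(X))$. *)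

(* Defs.v *)
From HB Require Import structures.
From mathcomp Require Import all_boot all_order all_algebra.
(* For extensional equality and the choice structure of power series. *)
From mathcomp Require Import boolp.

Set Implicit Arguments.
Unset Strict Implicit.
Unset Printing Implicit Defensive.

Import GRing.Theory.
Local Open Scope ring_scope.

(* The record, rather than the bare function type, carries the ring structure:
   nat -> R is a ring for the pointwise product. *)
Record fps (R : Type) := FPS { fps_coef :> nat -> R }.

Notation "{ 'fps' R }" := (fps R) (format "{ 'fps'  R }") : type_scope.

HB.instance Definition _ (R : Type) := gen_eqMixin {fps R}.
HB.instance Definition _ (R : Type) := gen_choiceMixin {fps R}.

Lemma fpsP (R : Type) (f g : {fps R}) : (forall n, f n = g n) <-> f = g.
Proof.
by split=> [|->//]; case: f g => [f] [g] /= fg; congr FPS; exact: funext.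
Qed.

Section FpsRing.
Variable R : comNzRingType.
Implicit Types f g h : {fps R}.

Definition fps_zero : {fps R} := FPS (fun=> 0).
Definition fps_opp f : {fps R} := FPS (fun n => - f n).
Definition fps_add f g : {fps R} := FPS (fun n => f n + g n).
Definition fps_one : {fps R} := FPS (fun n => (n == 0%N)%:R).
Definition fps_mul f g : {fps R} :=
  FPS (fun n => \sum_(i < n.+1) f i * g (n - i)%N).

Fact fps_addA : associative fps_add.
Proof. by move=> f g h; apply/fpsP => n /=; rewrite addrA. Qed.

Fact fps_addC : commutative fps_add.
Proof. by move=> f g; apply/fpsP => n /=; rewrite addrC. Qed.

Fact fps_add0 : left_id fps_zero fps_add.
Proof. by move=> f; apply/fpsP => n /=; rewrite add0r. Qed.

Fact fps_addN : left_inverse fps_zero fps_opp fps_add.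
Proof. by move=> f; apply/fpsP => n /=; rewrite addNr. Qed.

HB.instance Definition _ :=
  GRing.isZmodule.Build {fps R} fps_addA fps_addC fps_add0 fps_addN.

Let trunc N f : {poly R} := \poly_(i < N.+1) f i.

Let coef_trunc N f i : (i <= N)%N -> (trunc N f)`_i = f i.
Proof. by move=> iN; rewrite coef_poly ltnS iN. Qed.

Let coef_mul_trunc N f g i : (i <= N)%N ->
  (trunc N f * trunc N g)`_i = fps_mul f g i.
Proof.
move=> iN; rewrite coefM; apply: eq_bigr => j _.
rewrite !coef_trunc //; first exact: leq_trans (leq_subr _ _) iN.
by apply: leq_trans iN; rewrite -ltnS.
Qed.

Fact fps_mulC : commutative fps_mul.
Proof.
by move=> f g; apply/fpsP => n; rewrite -!(coef_mul_trunc _ _ (leqnn n)) mulrC.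
Qed.

Fact fps_mulA : associative fps_mul.
Proof.
move=> f g h; apply/fpsP => n.
transitivity ((trunc n f * trunc n g * trunc n h)`_n).
  rewrite -mulrA coefM; apply: eq_bigr => i _.
  by rewrite (coef_trunc f (leq_ord i)) (coef_mul_trunc g h (leq_subr i n)).
rewrite coefM; apply: eq_bigr => i _.
by rewrite (coef_mul_trunc f g (leq_ord i)) (coef_trunc h (leq_subr i n)).
Qed.

Fact fps_mul1 : left_id fps_one fps_mul.
Proof.
move=> f; apply/fpsP => n /=.
by rewrite big_ord_recl subn0 mul1r big1 ?addr0 // => i _; rewrite mul0r.
Qed.

Fact fps_mulDl : left_distributive fps_mul fps_add.
Proof.
move=> f g h; apply/fpsP => n /=; rewrite -big_split /=.
by apply: eq_bigr => i _; rewrite mulrDl.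
Qed.

Fact fps_one_neq0 : fps_one != 0.
Proof.
by apply/eqP => /(congr1 (fun f : {fps R} => f 0%N)) /eqP; rewrite oner_eq0.
Qed.

HB.instance Definition _ :=
  GRing.Zmodule_isComNzRing.Build {fps R}
    fps_mulA fps_mulC fps_mul1 fps_mulDl fps_one_neq0.

Definition fpsX : {fps R} := FPS (fun n => (n == 1%N)%:R).

(* f(g(X)) = \sum_k f_k g(X)^k. When g has zero constant term, g ^+ k has no
   term of degree less than k, so truncating at k <= n loses nothing; the
   value is meaningless when g 0 <> 0. *)
Definition fps_comp f g : {fps R} :=
  FPS (fun n => \sum_(k < n.+1) f k * (g ^+ k) n).

(* The conditions on constant terms make both compositions meaningful. *)
Definition is_comp_inverse f g : Prop :=
  [/\ f 0%N = 0, g 0%N = 0, fps_comp f g = fpsX & fps_comp g f = fpsX].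

End FpsRing.

Arguments fpsX {R}.

Definition period_doubling (n : nat) : nat := (logn 2 n.+1 %% 2)%N.

Definition period_doubling_series : {fps 'F_2} :=
  FPS (fun n => (period_doubling n)%:R).

(* Main.v *)
Require Import Defs.
From mathcomp Require Import all_boot all_order all_algebra.
From mathcomp Require Import zify ring.

(** The binary recursion [d_(2n) = 0], [d_(2n+1) = 1 + d_n], together with the
    fact that squaring a series over ['F_2] amounts to substituting [X^2] for
    [X], says that [D = X / (1 + X)^2 + X D^2], that is,
    [(1 + X^2) D = X + X (1 + X^2) D^2] ([period_doubling_eq]).  Substituting a
    series without constant term is compatible with sums and products
    ([fps_compD], [fps_compM]), so substituting [U] in this equation exchanges
    the roles of the two unknowns: [X] becomes [U] and [D] becomes [X].  The
    result is the cubic equation for [U].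

    The quartic equation is the cubic one multiplied by [X U + 1]; the factor
    is chosen so that only the powers [1], [U], [U^2] and [U^4] survive.  It
    therefore reads [U = X + X^3 U^2 + X^3 U^4], and as the coefficients of
    [U^2] and [U^4] are those of [U] spread out over the multiples of 2 and 4
    ([coef_sqr_F2]), comparing coefficients gives the recurrences. *)

Set Implicit Arguments.
Unset Strict Implicit.
Unset Printing Implicit Defensive.

Import GRing.Theory.
Local Open Scope ring_scope.

(** * Coefficients and substitution of power series *)

Section Composition.
Variable R : comNzRingType.
Implicit Types f g h : {fps R}.

Lemma fps_coefD f g n : (f + g) n = f n + g n.
Proof. by []. Qed.

Lemma fps_coefM f g n : (f * g) n = \sum_(i < n.+1) f i * g (n - i)%N.
Proof. by []. Qed.

Lemma fps_coef1 n : (1 : {fps R}) n = (n == 0%N)%:R.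
Proof. by []. Qed.

Lemma fps_coefXM0 f : (fpsX * f) 0%N = 0.
Proof. by rewrite fps_coefM big_ord_recl big_ord0 /= mul0r addr0. Qed.

Lemma fps_coefXMS f n : (fpsX * f) n.+1 = f n.
Proof.
rewrite fps_coefM big_ord_recl big_ord_recl /= mul0r add0r mul1r subn1 /=.
by rewrite big1 ?addr0 // => i _; rewrite mul0r.
Qed.

(** Every power of [g] picks up at least one more factor [X], which is what
    makes the truncated sum defining [fps_comp] the actual composition. *)
Lemma coef_exp_lt g k n : g 0%N = 0 -> (n < k)%N -> (g ^+ k) n = 0.
Proof.
move=> g0; elim: k n => // k IHk n lt_nk.
rewrite exprS fps_coefM big1 // => [[[|i] /= lt_in] _]; first by rewrite g0 mul0r.
by rewrite IHk ?mulr0 //; lia.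
Qed.

(** The bound in the definition of [fps_comp] depends on the degree of the
    coefficient; products involve several degrees and need a common bound. *)
Lemma fps_comp_widen f g n N : g 0%N = 0 -> (n <= N)%N ->
  fps_comp f g n = \sum_(0 <= k < N.+1) f k * (g ^+ k) n.
Proof.
move=> g0 le_nN; rewrite /= -(big_mkord xpredT (fun k => f k * (g ^+ k) n)).
rewrite [RHS](big_cat_nat (n := n.+1)) //= [X in _ = _ + X]big_nat_cond.
rewrite [X in _ = _ + X]big1 ?addr0 // => k /andP[/andP[lt_nk _] _].
by rewrite coef_exp_lt ?mulr0.
Qed.

Lemma fps_compD f h g : fps_comp (f + h) g = fps_comp f g + fps_comp h g.
Proof.
apply/fpsP => n; rewrite fps_coefD /= -big_split /=.
by apply: eq_bigr => k _; rewrite mulrDl.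
Qed.

Lemma fps_comp1 g : fps_comp 1 g = 1.
Proof.
apply/fpsP => n; rewrite /= big_ord_recl mul1r.
by rewrite big1 ?addr0 // => i _; rewrite mul0r.
Qed.

Lemma fps_compX g : g 0%N = 0 -> fps_comp fpsX g = g.
Proof.
move=> g0; apply/fpsP => n; rewrite (fps_comp_widen _ g0 (leqnSn n)).
rewrite big_nat_recl // big_nat_recl // big1 ?addr0 /=.
  by rewrite mul0r add0r mul1r expr1.
by move=> i _; rewrite mul0r.
Qed.

(** Both sides are the sum of [f_i h_j (g^(i+j))_n] over [i, j]: on the left
    the pairs are grouped by [k = i + j], on the right they range over a
    square, whose part [i + j > n] contributes nothing. *)
Lemma fps_compM f h g : g 0%N = 0 ->
  fps_comp (f * h) g = fps_comp f g * fps_comp h g.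
Proof.
move=> g0; apply/fpsP => n.
pose F i j := f i * h j * (g ^+ (i + j)) n.
transitivity (\sum_(0 <= i < n.+1) \sum_(0 <= j < n.+1) F i j).
  rewrite (fps_comp_widen _ g0 (leqnn n)).
  transitivity
    (\sum_(0 <= k < n.+1) \sum_(0 <= i < n.+1 | (i <= k)%N) F i (k - i)%N).
    apply: eq_big_nat => k /andP[_ lt_kn].
    rewrite fps_coefM mulr_suml.
    rewrite -(big_mkord xpredT (fun i => f i * h (k - i)%N * (g ^+ k) n)).
    rewrite (big_nat_widen _ _ n.+1) //= big_nat_cond [RHS]big_nat_cond.
    apply: eq_big => [i|i /andP[_ le_ik]]; first by rewrite ltnS.
    by rewrite /F subnKC.
  rewrite (exchange_big_dep_nat xpredT) //=.
  apply: eq_big_nat => i /andP[_ lt_in].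
  rewrite [RHS](big_cat_nat (n := (n.+1 - i)%N)) ?leq_subr //=.
  rewrite [X in _ = _ + X]big_nat_cond [X in _ = _ + X]big1 ?addr0; last first.
    move=> j /andP[/andP[le_j _] _]; rewrite /F coef_exp_lt ?mulr0 //.
    lia.
  have -> : \sum_(0 <= k < n.+1 | (i <= k)%N) F i (k - i)%N
            = \sum_(i <= k < n.+1) F i (k - i)%N.
    by rewrite [RHS](big_nat_widenl _ 0).
  rewrite -{1}[i]add0n big_addn.
  by apply: eq_bigr => j _; rewrite addnK.
rewrite fps_coefM.
transitivity (\sum_(a < n.+1) \sum_(0 <= i < n.+1) \sum_(0 <= j < n.+1)
   (f i * (g ^+ i) a) * (h j * (g ^+ j) (n - a)%N)); last first.
  apply: eq_bigr => a _.
  rewrite (fps_comp_widen f g0 (leq_ord a)).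
  rewrite (fps_comp_widen h g0 (leq_subr a n)).
  by rewrite big_distrl /=; apply: eq_bigr => i _; rewrite big_distrr.
rewrite [RHS]exchange_big /=; apply: eq_bigr => i _.
rewrite [RHS]exchange_big /=; apply: eq_bigr => j _.
rewrite /F exprD fps_coefM big_distrr /=; apply: eq_bigr => a _.
by rewrite mulrACA.
Qed.

End Composition.

(** * Characteristic two *)

Lemma fps_F2_double (f : {fps 'F_2}) : f + f = 0.
Proof.
by apply/fpsP => n; rewrite fps_coefD -mulr2n -mulr_natl (pchar_Fp_0 (p := 2)) ?mul0r.
Qed.

(** Writing [f = f_0 + X g], the cross terms of the square cancel and
    [f^2 = f_0 + X^2 g^2], so that the claim for [g] gives the one for [f]. *)
Lemma coef_sqr_F2 (f : {fps 'F_2}) n :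
  (f ^+ 2) n = if odd n then 0 else f n./2.
Proof.
have [m] := ubnP n; elim: m n f => // m IHm n f le_nm.
pose c : {fps 'F_2} := if f 0%N == 0 then 0 else 1.
pose g : {fps 'F_2} := FPS (fun k => f k.+1).
have def_f : f = c + fpsX * g.
  apply/fpsP => -[|k]; rewrite fps_coefD ?fps_coefXM0 ?fps_coefXMS /c.
    by case: (f 0%N) => [[|[|?]] ?] //; apply: val_inj.
  by case: eqP => _; rewrite ?fps_coef1 add0r.
have cc : c ^+ 2 = c by rewrite /c; case: eqP; rewrite ?expr1n // expr0n.
have -> : f ^+ 2 = c + fpsX * (fpsX * g ^+ 2).
  have -> : f ^+ 2 = c ^+ 2 + fpsX * (fpsX * g ^+ 2)
                     + (c * (fpsX * g) + c * (fpsX * g)).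
    by rewrite def_f; ring.
  by rewrite fps_F2_double addr0 cc.
have cS k : c k.+1 = 0 by rewrite /c; case: eqP.
case: n le_nm => [|[|n]] le_nm; rewrite fps_coefD ?fps_coefXM0 ?fps_coefXMS ?fps_coefXM0.
- by rewrite def_f fps_coefD fps_coefXM0.
- by rewrite cS addr0.
by rewrite cS add0r IHm /= ?negbK //; lia.
Qed.

(** * The period-doubling series *)

Lemma period_doubling_series_even n :
  period_doubling_series (2 * n)%N = 0.
Proof. by rewrite /= /period_doubling lognE dvdn2 /= oddM. Qed.

Lemma period_doubling_series_odd n :
  period_doubling_series (2 * n).+1 = 1 + period_doubling_series n.
Proof.
rewrite /= /period_doubling.
have -> : (2 * n).+2 = (2 * n.+1)%N by lia.
rewrite lognM // (logn_prime 2) // eqxx !modn2 /=.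
by case: odd; apply: val_inj.
Qed.

(** Clearing the denominator of [D = X (Q + D^2)], where the series [Q] of the
    indicator function of the even numbers is [1 / (1 + X^2)]. *)
Lemma period_doubling_eq (D := period_doubling_series) :
  (1 + fpsX * fpsX) * D = fpsX + fpsX * (1 + fpsX * fpsX) * (D * D).
Proof.
pose Q : {fps 'F_2} := FPS (fun n => (~~ odd n)%:R).
have Q_eq : (1 + fpsX * fpsX) * Q = 1.
  apply/fpsP => n; rewrite mulrDl mul1r -mulrA fps_coefD fps_coef1.
  case: n => [|[|n]]; rewrite ?fps_coefXMS ?fps_coefXM0 ?addr0 //.
  by rewrite /= negbK; case: odd; apply: val_inj.
have D_eq : D = fpsX * (Q + D * D).
  apply/fpsP => n; rewrite -expr2.
  have /orP[/eqP->|/eqP->] : (n == 2 * n./2)%N || (n == (2 * n./2).+1) by lia.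
    rewrite period_doubling_series_even; case: n./2 => [|m].
      by rewrite muln0 fps_coefXM0.
    have -> : (2 * m.+1 = (2 * m).+2)%N by lia.
    by rewrite fps_coefXMS fps_coefD coef_sqr_F2 /= oddM addr0.
  rewrite fps_coefXMS fps_coefD coef_sqr_F2 period_doubling_series_odd.
  by rewrite /= oddM /= mul2n doubleK.
rewrite [in LHS]D_eq.
have -> : (1 + fpsX * fpsX) * (fpsX * (Q + D * D))
          = fpsX * ((1 + fpsX * fpsX) * Q)
            + fpsX * (1 + fpsX * fpsX) * (D * D) by ring.
by rewrite Q_eq mulr1.
Qed.

(** * The compositional inverse *)

Lemma comp_inverse_cubic (U : {fps 'F_2}) :
    is_comp_inverse period_doubling_series U ->
  fpsX ^+ 2 * U ^+ 3 + fpsX * U ^+ 2 + (fpsX ^+ 2 + 1) * U + fpsX = 0.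
Proof.
case=> _ U0 DU _.
have := congr1 (fun f : {fps 'F_2} => fps_comp f U) period_doubling_eq.
rewrite !(fps_compD, fps_compM, fps_comp1, fps_compX) // DU => eqU.
have -> : fpsX ^+ 2 * U ^+ 3 + fpsX * U ^+ 2 + (fpsX ^+ 2 + 1) * U + fpsX
          = (1 + U * U) * fpsX + (U + U * (1 + U * U) * (fpsX * fpsX)) by ring.
by rewrite -eqU fps_F2_double.
Qed.

Lemma quartic_of_cubic (U : {fps 'F_2}) :
    fpsX ^+ 2 * U ^+ 3 + fpsX * U ^+ 2 + (fpsX ^+ 2 + 1) * U + fpsX = 0 ->
  fpsX ^+ 3 * U ^+ 4 + fpsX ^+ 3 * U ^+ 2 + U + fpsX = 0.
Proof.
move=> cubic.
(* T collects the terms that occur twice in the product. *)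
pose T := fpsX ^+ 2 * U ^+ 3 + fpsX * U ^+ 2 + fpsX ^+ 2 * U.
have -> : fpsX ^+ 3 * U ^+ 4 + fpsX ^+ 3 * U ^+ 2 + U + fpsX
          = (fpsX * U + 1) * (fpsX ^+ 2 * U ^+ 3 + fpsX * U ^+ 2
                              + (fpsX ^+ 2 + 1) * U + fpsX) - (T + T).
  by rewrite /T; ring.
by rewrite cubic mulr0 fps_F2_double subr0.
Qed.

Lemma coef_quartic (U : {fps 'F_2}) n :
    fpsX ^+ 3 * U ^+ 4 + fpsX ^+ 3 * U ^+ 2 + U + fpsX = 0 ->
  U n.+3 = if odd n then 0 else U n./2 + if odd n./2 then 0 else U n./2./2.
Proof.
move=> quartic.
pose T := fpsX * (fpsX * (fpsX * (U ^+ 2 + (U ^+ 2) ^+ 2))).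
have U_eq : U = fpsX + T.
  have <- : fpsX ^+ 3 * U ^+ 4 + fpsX ^+ 3 * U ^+ 2 + U + fpsX + (fpsX + T)
            = fpsX + T by rewrite quartic add0r.
  have -> : fpsX ^+ 3 * U ^+ 4 + fpsX ^+ 3 * U ^+ 2 + U + fpsX + (fpsX + T)
            = U + ((fpsX + T) + (fpsX + T)) by rewrite /T; ring.
  by rewrite fps_F2_double addr0.
have X_S3 : (fpsX : {fps 'F_2}) n.+3 = 0 by [].
rewrite [in LHS]U_eq fps_coefD X_S3 add0r !fps_coefXMS fps_coefD.
by rewrite !coef_sqr_F2; case: odd; rewrite ?addr0.
Qed.

Theorem proposition10 (U : {fps 'F_2})
    (hU : is_comp_inverse period_doubling_series U) :
  [/\ fpsX ^+ 2 * U ^+ 3 + fpsX * U ^+ 2 + (fpsX ^+ 2 + 1) * U + fpsX = 0,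
      fpsX ^+ 3 * U ^+ 4 + fpsX ^+ 3 * U ^+ 2 + U + fpsX = 0
    & [/\ U 0%N = 0,
          U 1%N = 1,
          forall n : nat, U (2 * n)%N = 0,
          forall n : nat, (1 <= n)%N -> U (4 * n + 1)%N = U (2 * n - 1)%N
        & forall n : nat, U (4 * n + 3)%N = U n]].
Proof.
have cubic := comp_inverse_cubic hU.
have quartic := quartic_of_cubic cubic.
have recU n := coef_quartic n quartic.
have [_ U0 _ _] := hU.
have [U1 U2] : U 1%N = 1 /\ U 2%N = 0.
  (* The terms of the quartic in U^2 and U^4 start at degree 3. *)
  have U_eq n : (fpsX * (fpsX * (fpsX * (U ^+ 4 + U ^+ 2))) + U + fpsX) n = 0.
    suff -> : fpsX * (fpsX * (fpsX * (U ^+ 4 + U ^+ 2))) + U + fpsX = 0 by [].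
    by rewrite -quartic; ring.
  have := U_eq 1%N; have := U_eq 2%N.
  rewrite !fps_coefD !fps_coefXMS !fps_coefXM0 /= !add0r addr0 => -> U1.
  by split=> //; apply: (addIr 1); rewrite U1; apply: val_inj.
have U_even n : U (2 * n)%N = 0.
  case: n => [|[|n]]; rewrite ?muln0 ?muln1 //.
  have -> : (2 * n.+2 = (2 * n).+1.+3)%N by lia.
  by rewrite recU /= oddM.
have half k : (2 * k)./2 = k by rewrite mul2n doubleK.
split=> //; split=> // n.
  case: n => // n _.
  have -> : (4 * n.+1 + 1 = (2 * (2 * n).+1).+3)%N by lia.
  have -> : (2 * n.+1 - 1 = (2 * n).+1)%N by lia.
  by rewrite recU half !oddM /= oddM /= addr0.
have -> : (4 * n + 3 = (2 * (2 * n)).+3)%N by lia.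
by rewrite recU !half !oddM /= U_even add0r.
Qed.
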